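(* Let $A'$ be the adjacency matrix of the Grassmann graph $\Gamma'$ on the $2$-dimensional subspaces of $V=\mathbb F_q^n$, where $n\ge4$ and $q=p^t$. Then the Sylow $p$-subgroup of the Smith group $S(\Gamma')$ is cyclic of order $p^t$.
   Context: Let $p$ be a prime, $q=p^t$ with $t\ge1$, $n\ge4$, and $V$ an $n$-dimensional vector space over $\mathbb F_q$. The Grassmann graph $\Gamma'$ has as vertices the $2$-dimensional subspaces of $V$, two distinct ones being adjacent when their intersection is nonzero; $A'$ is its adjacency matrix. The Smith group $S(\Gamma')$ is the cokernel of $A'$ viewed as an endomorphism of the free abelian group on the vertices ($A'$ is invertible over $\mathbb Q$, so this group is finite). *)

(* Defs.v *)
(* MathComp, with boolp used only to make membership in the image of an integer
   matrix boolean. *)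
From HB Require Import structures.
From mathcomp Require Import all_boot all_order all_algebra.
From mathcomp Require Import all_fingroup all_solvable.
From mathcomp Require Import boolp.

Set Implicit Arguments.
Unset Strict Implicit.
Unset Printing Implicit Defensive.

Import GRing.Theory.
Local Open Scope ring_scope.

Section Cokernel.
Variables (m n : nat) (A : 'M[int]_(m, n)).

Definition int_image : {pred 'cV[int]_m} :=
  fun v => `[< exists x : 'cV[int]_n, v = A *m x >].

Lemma int_image_zmod_closed : zmod_closed int_image.
Proof.
split=> [|u v]; first by apply/asboolP; exists 0; rewrite mulmx0.
move=> /asboolP[x ->] /asboolP[y ->]; apply/asboolP.
by exists (x - y); rewrite mulmxBr.
Qed.

HB.instance Definition _ :=
  GRing.isZmodClosed.Build 'cV[int]_m int_image int_image_zmod_closed.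

Definition cokermx_int : zmodType := Quotient.quot int_image.
End Cokernel.

(* The vertices are numbered by enum_val, and 'cV[int]_#|T| is the free abelian
   group on them. *)
Definition adjacency_matrix (T : finType) (e : rel T) : 'M[int]_#|T| :=
  \matrix_(i, j) (e (enum_val i) (enum_val j))%:R.

Definition smith_group (T : finType) (e : rel T) : zmodType :=
  cokermx_int (adjacency_matrix e).

Section Grassmann.
Variables (F : finFieldType) (V : vectType F).

(* {vspace V} is a subtype of a finite type of square matrices (the canonical
   bases); the subtype instance is only visible through this import. *)
Import VectorInternalTheory.
HB.instance Definition _ := [Countable of {vspace V} by <:].
HB.instance Definition _ := [Finite of {vspace V} by <:].

Definition subspace2 : finType := {U : {vspace V} | \dim U == 2%N}.

Definition grassmann_adj : rel subspace2 :=
  fun U W => (U != W) && ((val U :&: val W)%VS != 0%VS).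
End Grassmann.

(* The additive group G is finite, and all its Sylow p-subgroups are cyclic of
   order k.  The Sylow theory is that of finite groups, whose law is written
   multiplicatively; hence the passage through an isomorphism. *)
Definition has_cyclic_Sylow (p k : nat) (G : zmodType) : Prop :=
  exists (gT : finGroupType) (phi : G -> gT),
    [/\ bijective phi,
        {morph phi : x y / x + y >-> (x * y)%g}
      & forall P : {group gT}, (p.-Sylow([set: gT]) P)%g -> cyclic P /\ #|P| = k].

(* Main.v *)
Require Import Defs.
From HB Require Import structures.
From mathcomp Require Import all_boot all_order all_algebra.
From mathcomp Require Import all_fingroup all_solvable all_field.
From mathcomp Require Import boolp.
From mathcomp Require Import zify ring.

(* Let M be the line-point incidence matrix of the projective space: M M^T =
   (q + 1) I + A' and M^T M = r I + J, where r + 1 is the number of lines through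
   a point.  Hence A' (A' + a I) = b I + c J with b = -1 mod p, while the row sums
   of A' are k = (q + 1) r, whose p-part is q.  In the cokernel G of A' let u be
   the class of the all-one vector: k u = 0 and b G is contained in <u>, so the
   p-part of G is cyclic of order dividing q.  Conversely all vectors in the image
   of A' have coordinate sum divisible by k, so k divides the order of G. *)

Set Implicit Arguments.
Unset Strict Implicit.
Unset Printing Implicit Defensive.

Import GRing.Theory Num.Theory.
Local Open Scope quotient_scope.
Local Open Scope ring_scope.

(* sP does not occur in the body: it makes the group law below, which needs s to
   contain every sum, available to instance inference. *)
Definition mul_seq_sub (G : zmodType) (s : seq G) (sP : forall x, x \in s) :=
  seq_sub s.

(** * A finite additive group in multiplicative notation *)

Section MulSeqSub.
Variables (G : zmodType) (s : seq G) (sP : forall x, x \in s).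
Local Notation gT := (mul_seq_sub sP).

HB.instance Definition _ := Finite.on gT.

Definition mul_seq_sub_of (x : G) : gT := SeqSub (sP x).

Lemma mul_seq_subA :
  associative (fun x y : gT => mul_seq_sub_of (ssval x + ssval y)).
Proof. by move=> x y z; apply: val_inj; rewrite /= addrA. Qed.

Lemma mul1_seq_sub :
  left_id (mul_seq_sub_of 0) (fun x y : gT => mul_seq_sub_of (ssval x + ssval y)).
Proof. by move=> x; apply: val_inj; rewrite /= add0r. Qed.

Lemma mulV_seq_sub :
  left_inverse (mul_seq_sub_of 0) (fun x : gT => mul_seq_sub_of (- ssval x))
    (fun x y : gT => mul_seq_sub_of (ssval x + ssval y)).
Proof. by move=> x; apply: val_inj; rewrite /= addNr. Qed.

HB.instance Definition _ :=
  Finite_isGroup.Build gT mul_seq_subA mul1_seq_sub mulV_seq_sub.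

Lemma mul_seq_sub_ofD :
  {morph mul_seq_sub_of : x y / x + y >-> (x * y)%g}.
Proof. by move=> x y; apply: val_inj. Qed.

Lemma mul_seq_sub_of_bij : bijective mul_seq_sub_of.
Proof. by exists (@ssval _ s) => [x | x] //; apply: val_inj. Qed.

End MulSeqSub.

(** * The cokernel of a square integer matrix *)

Section Cokernel.
Variables (N : nat) (A : 'M[int]_N).
Local Notation G := (cokermx_int A).

Definition coker_pi (v : 'cV[int]_N) : G := \pi_(Quotient.quot (int_image A)) v.

Lemma coker_pi_is_zmod_morphism : zmod_morphism coker_pi.
Proof. by move=> u v; rewrite /coker_pi Quotient.pi_add Quotient.pi_opp. Qed.
HB.instance Definition _ :=
  GRing.isZmodMorphism.Build _ _ coker_pi coker_pi_is_zmod_morphism.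

Lemma coker_pi_eq0 v : coker_pi v = 0 <-> exists x, v = A *m x.
Proof.
rewrite -[0](raddf0 coker_pi); split=> [/eqmodP | [x ->]].
  by rewrite /= /Quotient.equiv subr0 => /asboolP.
by apply/eqmodP; rewrite /= /Quotient.equiv subr0; apply/asboolP; exists x.
Qed.

Lemma coker_pi_surj (x : G) : exists v, x = coker_pi v.
Proof.
exists (generic_quotient.repr (x : Quotient.quot (int_image A))).
by rewrite /coker_pi reprK.
Qed.

(** As [m] kills the cokernel, reducing coordinates modulo [m] keeps the class, so the vectors with
    entries from 0 to [m] - 1 represent all classes. *)
Lemma coker_finite (m : nat) :
  (0 < m)%N -> (forall x : G, x *+ m = 0) -> exists s : seq G, forall x, x \in s.
Proof.
case: m => // m _ Gm.
exists [seq coker_pi (map_mx (fun i : 'I_m.+1 => (i : nat)%:Z) v)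
       | v <- enum {: 'cV['I_m.+1]_N}] => x.
have [v ->] := coker_pi_surj x.
pose w : 'cV['I_m.+1]_N := map_mx (fun a => inord `|(a %% m.+1%:Z)%Z|) v.
apply/mapP; exists w; rewrite ?mem_enum //.
apply/eqP; rewrite -subr_eq0 -raddfB.
suff -> : v - map_mx (fun i : 'I_m.+1 => (i : nat)%:Z) w =
  map_mx (fun a => (a %/ m.+1%:Z)%Z) v *+ m.+1 by rewrite raddfMn Gm.
apply/matrixP=> i j; rewrite mulmxnE !mxE inordK; last first.
  by rewrite -ltz_nat gez0_abs ?modz_ge0 // ltz_pmod.
by rewrite gez0_abs ?modz_ge0 // {1}(divz_eq (v i j) m.+1) addrK -mulr_natr natz.
Qed.

End Cokernel.

(** Row sums serve the upper bound on the Sylow order, column sums the lower one; [b] acts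
    invertibly on elements of p-power order. *)
Lemma cokermx_int_Sylow (p N k : nat) (b c : int) (A B : 'M[int]_N) :
    prime p -> (0 < N)%N -> (0 < k)%N -> coprime p `|b| ->
    A *m const_mx 1 = const_mx k%:Z :> 'cV_N ->
    const_mx 1 *m A = const_mx k%:Z :> 'rV_N ->
    A *m B = b%:M + const_mx c ->
  has_cyclic_Sylow p k`_p (cokermx_int A).
Proof.
move=> p_pr N_gt0 k_gt0 co_pb A1 oneA AB.
pose pi := @coker_pi _ A; pose u := pi (const_mx 1).
have b_neq0 : `|b|%N != 0%N.
  by apply: contraTneq co_pb => ->; rewrite /coprime gcdn0 neq_ltn prime_gt1 ?orbT.
have constM (d : int) v :
    const_mx d *m v = (\sum_i v i 0 * d) *: (const_mx 1 : 'cV[int]_N).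
  apply/matrixP=> i j; rewrite !mxE mulr1 ord1; apply: eq_bigr => l _.
  by rewrite mxE mulrC.
have uk : u *+ k = 0.
  rewrite -raddfMn; apply/coker_pi_eq0; exists (const_mx 1).
  by rewrite A1; apply/matrixP=> i j; rewrite mulmxnE !mxE natz.
(* With J the all-one matrix, b v = A B v - c J v, and J v is the coordinate sum of v times the
   all-one vector. *)
have bG (x : cokermx_int A) : exists d : int, x *~ b = u *~ d.
  have [v ->] := coker_pi_surj x; exists (- (\sum_i v i 0 * c)).
  rewrite -!(raddfMz pi); apply/eqP; rewrite -subr_eq0 -raddfB; apply/eqP/coker_pi_eq0.
  exists (B *m v); rewrite mulmxA AB mulmxDl constM mul_scalar_mx -!scaler_int !intz.
  by rewrite scaleNr opprK.
(* Finiteness needs a positive multiple killing everything: [b] sends the cokernel into the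
   multiples of [u], and [k] kills [u]. *)
have Gbk (x : cokermx_int A) : x *+ (`|b| * k) = 0.
  suff /eqP : x *~ b *+ k = 0.
    case: b {co_pb AB bG b_neq0} => m.
      by rewrite -pmulrn -mulrnA => /eqP.
    by rewrite NegzE mulrNz -pmulrn mulNrn oppr_eq0 -mulrnA => /eqP.
  have [d ->] := bG x.
  by rewrite pmulrn -mulrzA mulrC mulrzA -pmulrn uk mul0rz.
have [|s sP] := coker_finite _ Gbk; first by rewrite muln_gt0 lt0n b_neq0.
pose phi := mul_seq_sub_of sP.
exists (mul_seq_sub sP), phi; split=> [||P sylP].
- exact: mul_seq_sub_of_bij.
- exact: mul_seq_sub_ofD.
have phi0 : phi 0 = 1%g by apply: val_inj.
have phiN x : phi (- x) = (phi x)^-1%g by apply: val_inj.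
have phiM x m : phi (x *+ m) = (phi x ^+ m)%g.
  by elim: m => [|m IHm] //; rewrite mulrS expgS -IHm -mul_seq_sub_ofD.
have phiV z : z = phi (ssval z) by apply: val_inj.
have pP := pHall_pgroup sylP.
have oU : (#[phi u]%g %| k)%N by rewrite order_dvdn -phiM uk phi0.
(* The order of z in [P] is a power of p, hence coprime to [b], so z is recovered from its power of
   exponent |b|, which lies in the group generated by [u]. *)
have sPU : P \subset <[phi u]>%g.
  apply/subsetP=> z Pz.
  have co_zb : coprime #[z]%g `|b|.
    by have /p_natP[e ->] := mem_p_elt pP Pz; rewrite coprimeXl.
  have /eqP zb : generator <[z]>%g (z ^+ `|b|)%g by rewrite generator_coprime.
  rewrite -cycle_subG zb cycle_subG; have [d xd] := bG (ssval z).
  rewrite (phiV z) -phiM.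
  have phiZ y : phi (y *~ d) \in <[phi y]>%g.
    case: (d) => m; first by rewrite -pmulrn phiM mem_cycle.
    by rewrite NegzE mulrNz phiN groupV -pmulrn phiM mem_cycle.
  case: b xd {co_zb zb bG Gbk AB co_pb b_neq0} => m.
    by rewrite -pmulrn => ->.
  rewrite NegzE mulrNz abszN => /(canRL opprK); rewrite -pmulrn => ->.
  by rewrite phiN groupV.
split; first exact: cyclicS sPU (cycle_cyclic _).
(* Upper bound: [P] is a p-group inside a cyclic group of order dividing [k]. Lower bound: it
   remains to see that [k] divides the order of the cokernel. *)
apply/eqP; rewrite eqn_dvd; apply/andP; split.
  rewrite -(part_pnat_id pP) partn_dvd //.
  exact: dvdn_trans (cardSg sPU) oU.
rewrite (card_Hall sylP) partn_dvd ?cardG_gt0 //.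
(* A multiple m e of a unit vector has coordinate sum m; here m is the order of
   the cokernel, so m e is in the image of A. *)
have [x Ax] : exists x, (delta_mx (Ordinal N_gt0) 0 : 'cV[int]_N)
    *+ #|[set: mul_seq_sub sP]| = A *m x.
  apply/coker_pi_eq0; rewrite raddfMn.
  apply: (bij_inj (mul_seq_sub_of_bij sP)); rewrite -/phi phi0 phiM.
  by apply: expg_cardG; rewrite inE.
have := congr1 (mulmx (const_mx 1 : 'rV_N)) Ax; rewrite mulmxA oneA => /matrixP/(_ 0 0).
rewrite mxE (bigD1 (Ordinal N_gt0)) //= big1 => [|i /negPf ni]; last first.
  by rewrite mulmxnE !mxE ni mul0rn mulr0.
rewrite mulmxnE !mxE !eqxx /= addr0 mul1r => def_m.
change (k%:Z %| #|[set: mul_seq_sub sP]|%:Z)%Z; rewrite -natz def_m.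
by apply: rpred_sum => i _; rewrite mxE dvdz_mulr.
Qed.

(** * Incidence matrices of a finite linear space *)

Lemma adjacency_matrix_tr (T : finType) (e : rel T) :
  symmetric e -> (adjacency_matrix e)^T = adjacency_matrix e.
Proof. by move=> e_sym; apply/matrixP=> i j; rewrite !mxE e_sym. Qed.

Section LinearSpace.
(** [T] holds the lines, [S] the points, and [e] relates distinct lines that meet. Writing the
    degree as [r.+1] makes [r] itself the eigenvalue of M^T M on vectors of coordinate sum 0. *)
Variables (T S : finType) (inc : T -> S -> bool) (e : rel T) (l r : nat).
Hypothesis line_size : forall U, #|[pred P | inc U P]| = l.
Hypothesis point_degree : forall P, #|[pred U | inc U P]| = r.+1.
Hypothesis join1 :
  forall P Q, P != Q -> #|[pred U | inc U P && inc U Q]| = 1%N.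
Hypothesis e_irr : irreflexive e.
Hypothesis meetE :
  forall U W, U != W -> #|[pred P | inc U P && inc W P]| = e U W.

Let A := adjacency_matrix e.
Let M : 'M[int]_(#|T|, #|S|) :=
  \matrix_(i, j) (inc (enum_val i) (enum_val j))%:R.

Let sum_enum (X : finType) (p : pred X) :
  \sum_(i < #|X|) (p (enum_val i))%:R = #|p|%:R :> int.
Proof.
rewrite -natr_sum -sum1_card [in RHS]big_mkcond; congr _%:R.
symmetry; exact: (@big_enum_val _ _ _ X X (fun x => p x : nat)).
Qed.

Let adjE : A = M *m M^T - l%:R%:M.
Proof.
apply/matrixP=> i j; rewrite !mxE; under eq_bigr do rewrite !mxE -natrM mulnb.
rewrite (sum_enum [pred P | inc (enum_val i) P && inc (enum_val j) P]).
have [<-|nij] := eqVneq i j; last first.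
  by rewrite meetE ?mulr0n ?subr0 //; apply: contraNneq nij => /enum_val_inj ->.
rewrite e_irr mulr1n -(line_size (enum_val i)); apply/esym/eqP.
by rewrite subr_eq0; apply/eqP; congr _%:R; apply: eq_card => P; rewrite !inE andbb.
Qed.

Let trMM : M^T *m M = r%:R%:M + const_mx 1.
Proof.
apply/matrixP=> i j; rewrite !mxE; under eq_bigr do rewrite !mxE -natrM mulnb.
rewrite (sum_enum [pred U | inc U (enum_val i) && inc U (enum_val j)]).
have [<-|nij] := eqVneq i j; last first.
  by rewrite join1 ?mulr0n ?add0r //; apply: contraNneq nij => /enum_val_inj ->.
rewrite mulr1n natr1 -(point_degree (enum_val i)); congr _%:R.
by apply: eq_card => U; rewrite !inE andbb.
Qed.

Let M1 m : M *m const_mx 1 = const_mx l%:R :> 'M_(_, m).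
Proof.
apply/matrixP=> i j; rewrite !mxE; under eq_bigr do rewrite !mxE mulr1.
by rewrite (sum_enum [pred P | inc (enum_val i) P]) line_size.
Qed.

Let trM1 m : M^T *m const_mx 1 = const_mx r.+1%:R :> 'M_(_, m).
Proof.
apply/matrixP=> i j; rewrite !mxE; under eq_bigr do rewrite !mxE mulr1.
by rewrite (sum_enum [pred U | inc U (enum_val i)]) point_degree.
Qed.

Let const_mxZ m n (a : int) : const_mx a = a *: const_mx 1 :> 'M_(m, n).
Proof. by apply/matrixP=> i j; rewrite !mxE mulr1. Qed.

(** On all-one vectors M^T acts as r + 1 and M as l, so M M^T - l I has row sums l (r + 1) - l. *)
Lemma linear_space_regular :
  A *m const_mx 1 = const_mx (l * r)%:R :> 'cV_#|T|.
Proof.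
rewrite adjE mulmxBl -mulmxA trM1 const_mxZ -scalemxAr M1 mul_scalar_mx.
by apply/matrixP=> i j; rewrite !mxE -natr1 natrM; ring.
Qed.

(** Put X = M M^T. Then X^2 = M (r I + J) M^T = r X + l^2 J. The shift turns the second factor into
    X + (l - r) I, so the product with X - l I is X^2 - r X + l (r - l) I, where the terms in X
    cancel. *)
Lemma linear_space_quadratic :
  A *m (A + (l%:R *+ 2 - r%:R)%:M) =
    (l%:R * (r%:R - l%:R))%:M + const_mx (l%:R ^+ 2).
Proof.
have MJM : M *m const_mx 1 *m M^T = const_mx (l%:R ^+ 2).
  rewrite M1; apply: trmx_inj; rewrite trmx_mul trmxK !trmx_const const_mxZ.
  by rewrite -scalemxAr M1 const_mxZ scalerA -const_mxZ -expr2.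
have MMMM : M *m M^T *m (M *m M^T) = r%:R *: (M *m M^T) + const_mx (l%:R ^+ 2).
  rewrite mulmxA -(mulmxA M) trMM mulmxDr mulmxDl MJM.
  by rewrite mul_mx_scalar -scalemxAl.
rewrite adjE; move: (M *m M^T) MMMM => X XX.
rewrite mulmxBl !mulmxDr mulmxN XX !mul_mx_scalar !mul_scalar_mx.
apply/matrixP=> i j; rewrite !mxE; case: (i == j); rewrite ?mulr1n ?mulr0n; ring.
Qed.

End LinearSpace.

(** * Counting subspaces over a finite field *)

Section SubspaceCount.
Variables (F : finFieldType) (V : vectType F).
Implicit Types P U W : {vspace V}.

Lemma card_finvect W :
  #|[pred v : finvect_type V | v \in W]| = (#|F| ^ \dim W)%N.
Proof.
case: V W => T cT W.
exact: (@card_vspace F (finvect_type (Vector.Pack cT)) cT W).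
Qed.

(** Double counting of pairs (U, v) with v in U outside P: a vector v of W outside P lies in exactly
    one such U, namely P + <v>. *)
Lemma card_subspaces_succ P W : (P <= W)%VS ->
  (#|[pred U : {vspace V} | [&& \dim U == (\dim P).+1, P <= U & U <= W]%VS]|
     * (#|F| ^ (\dim P).+1 - #|F| ^ \dim P) = #|F| ^ \dim W - #|F| ^ \dim P)%N.
Proof.
move=> sPW; pose fV := finvect_type V.
have cardD (X : {vspace V}) : (P <= X)%VS ->
    #|[pred v : fV | (v \in X) && (v \notin P)]| = (#|F| ^ \dim X - #|F| ^ \dim P)%N.
  move=> sPX; rewrite -!card_finvect.
  rewrite -(cardID [pred v : fV | v \in P] [pred v : fV | v \in X]).
  have -> : #|[predI [pred v : fV | v \in X] & [pred v : fV | v \in P]]| =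
      #|[pred v : fV | v \in P]|.
    by apply: eq_card => v; rewrite !inE andb_idl // => /(subvP sPX).
  by rewrite addKn; apply: eq_card => v; rewrite !inE andbC.
set S := [pred U | _].
have uniqU v : v \in W -> v \notin P ->
    forall U, (U \in S) && (v \in U) = (U == P + <[v]>)%VS.
  move=> Wv Pv; have dimPv : \dim (P + <[v]>) = (\dim P).+1.
    rewrite dimv_disjoint_sum ?dim_vline ?addn1.
      by case: eqVneq Pv => [->|]; rewrite ?mem0v // addn1.
    apply/eqP; rewrite -subv0; apply/subvP=> x; rewrite memv_cap memv0.
    case/andP=> Px /vlineP[a def_x]; apply: contraR Pv; rewrite def_x => nz_av.
    have nz_a : a != 0 by apply: contraNneq nz_av => ->; rewrite scale0r.
    by rewrite -[v](scalerK nz_a) memvZ // -def_x.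
  move=> U; apply/idP/eqP=> [|->]; last first.
    by rewrite !inE dimPv eqxx addvSl subv_add sPW -!memvE Wv memvE addvSr.
  rewrite !inE => /andP[/and3P[/eqP dU sPU _] Uv]; apply/esym/eqP.
  by rewrite eqEdim dU dimPv leqnn subv_add sPU -memvE Uv.
rewrite -(cardD W sPW) -[RHS]sum1_card -sum_nat_const.
transitivity (\sum_(U in S) \sum_(v : fV | (v \in W) && (v \notin P)) (v \in U))%N.
  apply: eq_bigr => U; rewrite inE => /and3P[/eqP dU sPU sUW].
  rewrite -dU -(cardD U sPU) -sum1_card big_mkcond [RHS]big_mkcond /=.
  apply: eq_bigr => v _; rewrite inE; case: (boolP (v \in U)) => [/(subvP sUW)->|_] //=.
  by case: ifP.
rewrite exchange_big; apply: eq_bigr => v /andP[Wv Pv].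
rewrite (eq_bigr (fun U => if v \in U then 1 else 0)%N) => [|U _]; last by case: (v \in U).
by rewrite -big_mkcondr (eq_bigl _ _ (uniqU v Wv Pv)) big_pred1_eq.
Qed.

End SubspaceCount.

Lemma card_sub_pred (T : finType) (P Q : pred T) :
  #|[pred x : {x | P x} | Q (val x)]| = #|[pred x | P x && Q x]|.
Proof.
rewrite -(card_image val_inj); apply: eq_card => x.
apply/imageP/andP => [[y Qy ->] | [Px Qx]]; first by split; [exact: valP|].
by exists (Sub x Px).
Qed.

(** * Points and lines of the projective space of [V] *)

Section GrassmannIncidence.
Variables (F : finFieldType) (V : vectType F).
Local Notation q := #|F|.

Definition subspace1 : finType := {P : {vspace V} | \dim P == 1%N}.

Definition grassmann_inc (U : subspace2 V) (P : subspace1) : bool :=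
  (val P <= val U)%VS.

Let q_gt1 : (1 < q)%N. Proof. exact: finNzRing_gt1. Qed.

Lemma card_subspace1 (W : {vspace V}) :
  (#|[pred P : subspace1 | (val P <= W)%VS]| * q.-1 = (q ^ \dim W).-1)%N.
Proof.
have := card_subspaces_succ (sub0v W); rewrite dimv0 expn0 expn1 !subn1 => <-.
rewrite (@card_sub_pred _ _ (fun P => P <= W)%VS); congr (_ * _)%N.
by apply: eq_card => P; rewrite !inE sub0v.
Qed.

Lemma grassmann_line_size U : #|[pred P | grassmann_inc U P]| = q.+1.
Proof.
apply/eqP; rewrite -(@eqn_pmul2r q.-1); last by lia.
by have /eqP dU := valP U; rewrite (card_subspace1 (val U)) dU; apply/eqP; nia.
Qed.

(** With n the dimension of [V], the degree is (q^(n-1) - 1)/(q - 1) = 1 + q w. This form displays r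
    = q w, the source of the factor q in the row sums. *)
Lemma grassmann_point_degree P w :
    (w * q.-1 = (q ^ (\dim {:V} - 2)).-1)%N -> (2 <= \dim {:V})%N ->
  #|[pred U | grassmann_inc U P]| = (q * w).+1.
Proof.
move=> wE dV; have /eqP dP := valP P.
have := card_subspaces_succ (subvf (val P)); rewrite dP expn1 expnS expn1.
rewrite -{1}(subnK dV) expnD.
rewrite (_ : #|_| = #|[pred U | grassmann_inc U P]|); last first.
  rewrite (@card_sub_pred _ _ (fun U => val P <= U)%VS).
  by apply: eq_card => U; rewrite !inE subvf andbT.
have : (0 < q ^ (\dim {:V} - 2))%N by rewrite expn_gt0 ltnW.
move: (q ^ _)%N wE #|[pred U | _]|%N => Q wE c Q_gt0.
have {Q_gt0}-> : Q = (w * q.-1).+1 by rewrite wE prednK.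
move: q.-1 (prednK (ltnW q_gt1)) q_gt1 => d <-; rewrite ltnS => d_gt0.
have -> : (d.+1 * d.+1 - d.+1 = d.+1 * d)%N by rewrite mulnS addKn.
(* Here [d] is q - 1, and q^n - q = q^2 (w d + 1) - q = (q w + 1) q d. *)
rewrite (_ : (_ - _ = (d.+1 * w).+1 * (d.+1 * d))%N); last first.
  by apply: (canLR (addnK _)); ring.
by move/eqP; rewrite eqn_pmul2r ?muln_gt0 // => /eqP.
Qed.

(** Distinct points meet in 0, so their sum has dimension 2 and is the only line through both. *)
Lemma grassmann_join1 P Q : P != Q ->
  #|[pred U | grassmann_inc U P && grassmann_inc U Q]| = 1%N.
Proof.
move=> nPQ; have /eqP dP := valP P; have /eqP dQ := valP Q.
have dPQ : \dim (val P :&: val Q) = 0%N.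
  apply/eqP; have := dimvS (capvSl (val P) (val Q)); rewrite dP.
  rewrite leq_eqVlt ltnS leqn0 => /orP[/eqP d1|//].
  have /eqP PE : (val P :&: val Q == val P)%VS by rewrite eqEdim capvSl d1 dP.
  have /eqP QE : (val P :&: val Q == val Q)%VS by rewrite eqEdim capvSr d1 dQ.
  by case/eqP: nPQ; apply: val_inj; rewrite -PE QE.
have d2 : \dim (val P + val Q) == 2%N.
  by have := dimv_sum_cap (val P) (val Q); rewrite dPQ dP dQ addn0 => ->.
apply: (@eq_card1 _ (exist _ (val P + val Q)%VS d2 : subspace2 V)) => U.
rewrite !inE /grassmann_inc -subv_add -val_eqE /= eq_sym eqEdim (eqP d2).
by have /eqP-> := valP U; rewrite andbT.
Qed.

Lemma grassmann_adj_irr : irreflexive (@grassmann_adj F V).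
Proof. by move=> U; rewrite /grassmann_adj eqxx. Qed.

Lemma grassmann_adj_sym : symmetric (@grassmann_adj F V).
Proof. by move=> U W; rewrite /grassmann_adj eq_sym capvC. Qed.

(** Distinct lines intersect in dimension 0 or 1, hence in no point or a single one. *)
Lemma grassmann_meetE U W : U != W ->
  #|[pred P | grassmann_inc U P && grassmann_inc W P]| = grassmann_adj U W.
Proof.
move=> nUW; rewrite /grassmann_adj nUW /= -dimv_eq0.
rewrite (_ : #|_| = #|[pred P : subspace1 | (val P <= val U :&: val W)%VS]|).
  have := card_subspace1 (val U :&: val W).
  have : (\dim (val U :&: val W) < 2)%N.
    have /eqP dU := valP U; have /eqP dW := valP W.
    have := dimvS (capvSl (val U) (val W)); rewrite dU leq_eqVlt => /orP[/eqP d2|//].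
    have /eqP UE : (val U :&: val W == val U)%VS by rewrite eqEdim capvSl d2 dU.
    have /eqP WE : (val U :&: val W == val W)%VS by rewrite eqEdim capvSr d2 dW.
    by case/eqP: nUW; apply: val_inj; rewrite -UE WE.
  move: #|_| => c; case: (\dim _) => [|[|//]] _ cE; apply/eqP.
    by rewrite -(@eqn_pmul2r q.-1) ?cE //; lia.
  by rewrite -(@eqn_pmul2r q.-1) ?cE ?expn1 ?mul1n //; lia.
by apply: eq_card => P; rewrite !inE subv_cap.
Qed.

End GrassmannIncidence.

(** * Arithmetic of the Grassmann parameters *)

Theorem mainTheorem3 (p t n : nat) (F : finFieldType) (V : vectType F) :
  prime p -> (1 <= t)%N -> #|F| = (p ^ t)%N ->
  (4 <= n)%N -> \dim (fullv : {vspace V}) = n ->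
  has_cyclic_Sylow p (p ^ t)%N (smith_group (@grassmann_adj F V)).
Proof.
move=> p_pr t_gt0 qE n_ge4 dV.
have p_gt1 := prime_gt1 p_pr.
have q_gt1 : (1 < #|F|)%N by exact: finNzRing_gt1.
have pq : (p %| #|F|)%N by rewrite qE dvdn_exp.
(* This is 1 + q + ... + q^(n-3), the number of lines through a point in a fixed plane complementing
   nothing but that count: r = q w. *)
pose w := ((#|F| ^ (n - 2)).-1 %/ #|F|.-1)%N.
have wE : (w * #|F|.-1 = (#|F| ^ (n - 2)).-1)%N by rewrite divnK // dvdn_pred_predX.
have Q_gt1 : (1 < #|F| ^ (n - 2))%N by rewrite -(expn0 #|F|) ltn_exp2l; lia.
have w_gt0 : (0 < w)%N by lia.
have pNS m : (p %| m)%N -> ~~ (p %| m.+1)%N.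
  by move=> pm; rewrite -addn1 dvdn_addr // dvdn1 neq_ltn p_gt1 orbT.
(* Otherwise p would divide both q^(n-2) - 1 and q^(n-2). *)
have pw : ~~ (p %| w)%N.
  apply: contraL (pq) => pw; have := dvdn_mulr #|F|.-1 pw; rewrite wE => /pNS.
  rewrite prednK 1?ltnW //; apply: contra => {}pq.
  by rewrite (dvdn_trans pq) // dvdn_exp //; lia.
have deg (P : subspace1 V) : #|[pred U | grassmann_inc U P]| = (#|F| * w).+1.
  by apply: grassmann_point_degree; rewrite dV //; lia.
have lsize := @grassmann_line_size F V.
have join := @grassmann_join1 F V.
have irr := @grassmann_adj_irr F V.
have meet := @grassmann_meetE F V.
(* Both q + 1 and [w] are prime to p, and q is a power of p. *)
have kp : ((#|F|.+1 * (#|F| * w))`_p = p ^ t)%N.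
  have q_gt0 := ltnW q_gt1.
  rewrite !partnM ?muln_gt0 ?w_gt0 ?q_gt0 //.
  rewrite [X in (_ * (X * _))%N]part_pnat_id; last by rewrite qE pnatX pnat_id.
  rewrite !part_p'nat ?mul1n ?muln1 // p'natE //.
  exact: pNS.
rewrite -kp.
have A1 := linear_space_regular lsize deg irr meet.
have AB := linear_space_quadratic lsize deg join irr meet.
apply: cokermx_int_Sylow AB => //.
(* A vertex must exist: two vectors of a basis span one. *)
- have freeX : free (take 2 (vbasis {:V})).
    apply: (@catl_free _ _ (drop 2 (vbasis {:V}))).
    by rewrite cat_take_drop (basis_free (vbasisP _)).
  have dU : \dim <<take 2 (vbasis {:V})>> == 2%N.
    by move: freeX; rewrite /free size_takel // size_tuple dV ltnW // ltnW.
  by apply/card_gt0P; exists (exist _ <<take 2 (vbasis {:V})>>%VS dU : subspace2 V).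
- by rewrite !muln_gt0 w_gt0 (ltnW q_gt1).
- rewrite prime_coprime //.
  change (~~ (p%:Z %| #|F|.+1%:R * ((#|F| * w)%:R - #|F|.+1%:R))%Z).
  (* This form of [b] = (q + 1)(q w - (q + 1)) shows it to be -1 modulo q. *)
  rewrite (_ : _ * _ = #|F|%:R * (#|F|.+1%:R * (w%:R - 1) - 1) - 1).
    have pqz : (p%:Z %| #|F|%:R)%Z by rewrite natz.
    rewrite rpredBl ?dvdz_mulr //; change (~~ (p%:Z %| 1)%Z).
    by rewrite dvdz1 neq_ltn p_gt1 orbT.
  by rewrite -natr1 natrM; ring.
- by rewrite -natz A1.
(* Column sums equal row sums, adjacency being symmetric. *)
- apply: trmx_inj; rewrite trmx_mul !trmx_const.
  by rewrite (adjacency_matrix_tr (@grassmann_adj_sym F V)) A1 natz.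
Qed.
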